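(* If $\mathcal{C}$ is a locally finite abelian r-category whose simple objects are rigid, then $\mathcal{C}$ is rigid.
   Context: A locally finite abelian category is a $\mathbb{K}$-linear abelian category ($\mathbb{K}$ a field) with finite-dimensional morphism spaces and in which every object has finite length; the tensor product of an abelian monoidal category is assumed $\mathbb{K}$-bilinear. An object $K$ of a monoidal category $\mathcal{C}$ is dualizing if for every $X\in\mathcal{C}$ the functor $\mathrm{Hom}_{\mathcal{C}}(-\otimes X,K)$ is representable by an object $DX$ and the resulting contravariant functor $D:\mathcal{C}\to\mathcal{C}$ is an anti-equivalence. An r-category is a monoidal category equipped with a dualizing object which is isomorphic to the unit object $\mathbf{1}$. An object of a monoidal category is rigid if it has both a left dual and a right dual; a monoidal category is rigid if all its objects are rigid. *)

(* Defs.v *)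
From HB Require Import structures.
From mathcomp Require Import all_boot all_order all_algebra.
Set Implicit Arguments.
Unset Strict Implicit.
Unset Printing Implicit Defensive.
Import GRing.Theory.
Local Open Scope ring_scope.

Declare Scope cat_scope.
Delimit Scope cat_scope with cat.
Local Open Scope cat_scope.

Record category := Category {
  ob :> Type;
  mor : ob -> ob -> Type;
  idm : forall X, mor X X;
  compm : forall X Y Z, mor Y Z -> mor X Y -> mor X Z;
  comp1m : forall X Y (f : mor X Y), compm (idm Y) f = f;
  compm1 : forall X Y (f : mor X Y), compm f (idm X) = f;
  compmA : forall W X Y Z (h : mor Y Z) (g : mor X Y) (f : mor W X),
    compm h (compm g f) = compm (compm h g) f
}.
Arguments idm {c} X.

Notation "g \oc f" := (compm g f) (at level 40, left associativity) : cat_scope.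

Definition is_iso (C : category) (X Y : C) (f : mor X Y) : Prop :=
  exists g : mor Y X, g \oc f = idm X /\ f \oc g = idm Y.

Definition isomorphic (C : category) (X Y : C) : Prop :=
  exists f : mor X Y, is_iso f.

Definition monic (C : category) (X Y : C) (f : mor X Y) : Prop :=
  forall W (u v : mor W X), f \oc u = f \oc v -> u = v.

Definition epic (C : category) (X Y : C) (f : mor X Y) : Prop :=
  forall Z (u v : mor Y Z), u \oc f = v \oc f -> u = v.

Definition zero_object (C : category) (Z : C) : Prop :=
  forall X : C, (exists! f : mor Z X, True) /\ (exists! f : mor X Z, True).

Definition opposite (C : category) : category :=
  @Category C (fun X Y => mor Y X) (fun X => idm X)
    (fun X Y Z (g : mor Z Y) (f : mor Y X) => f \oc g)
    (fun X Y f => compm1 f) (fun X Y f => comp1m f)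
    (fun W X Y Z h g f => esym (compmA f g h)).

Record functor (C D : category) := Functor {
  fobj :> C -> D;
  fmap : forall X Y : C, mor X Y -> mor (fobj X) (fobj Y);
  fmap1 : forall X : C, fmap (idm X) = idm (fobj X);
  fmapM : forall (X Y Z : C) (g : mor Y Z) (f : mor X Y),
    fmap (g \oc f) = fmap g \oc fmap f
}.

Definition functor_id (C : category) : functor C C :=
  @Functor C C id (fun X Y f => f) (fun X => erefl) (fun X Y Z g f => erefl).

Definition functor_comp (C D E : category) (G : functor D E) (F : functor C D) :
    functor C E :=
  @Functor C E (fun X => G (F X)) (fun X Y f => fmap G (fmap F f))
    (fun X => etrans (f_equal (fmap G (Y := F X)) (fmap1 F X)) (fmap1 G (F X)))
    (fun X Y Z g f => etrans (f_equal (fmap G (Y := F Z)) (fmapM F g f))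
                             (fmapM G (fmap F g) (fmap F f))).

Definition naturally_isomorphic (C D : category) (F G : functor C D) : Prop :=
  exists alpha : forall X : C, mor (F X) (G X),
    (forall X, is_iso (alpha X)) /\
    (forall (X Y : C) (f : mor X Y),
       alpha Y \oc fmap F f = fmap G f \oc alpha X).

Definition is_equivalence (C D : category) (F : functor C D) : Prop :=
  exists G : functor D C,
    naturally_isomorphic (functor_comp G F) (functor_id C) /\
    naturally_isomorphic (functor_comp F G) (functor_id D).

Class monoidal (C : category) := Monoidal {
  tens : C -> C -> C;
  unit_ob : C;
  tensm : forall X X' Y Y' : C,
    mor X X' -> mor Y Y' -> mor (tens X Y) (tens X' Y');
  tensm1 : forall X Y : C, tensm (idm X) (idm Y) = idm (tens X Y);
  tensmM : forall (X X' X'' Y Y' Y'' : C)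
      (f' : mor X' X'') (f : mor X X') (g' : mor Y' Y'') (g : mor Y Y'),
    tensm (f' \oc f) (g' \oc g) = tensm f' g' \oc tensm f g;
  assoc : forall X Y Z : C, mor (tens (tens X Y) Z) (tens X (tens Y Z));
  assocV : forall X Y Z : C, mor (tens X (tens Y Z)) (tens (tens X Y) Z);
  assocK : forall X Y Z : C, assocV X Y Z \oc assoc X Y Z = idm _;
  assocVK : forall X Y Z : C, assoc X Y Z \oc assocV X Y Z = idm _;
  assoc_nat : forall (X X' Y Y' Z Z' : C)
      (f : mor X X') (g : mor Y Y') (h : mor Z Z'),
    assoc X' Y' Z' \oc tensm (tensm f g) h
      = tensm f (tensm g h) \oc assoc X Y Z;
  lunit : forall X : C, mor (tens unit_ob X) X;
  lunitV : forall X : C, mor X (tens unit_ob X);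
  lunitK : forall X : C, lunitV X \oc lunit X = idm _;
  lunitVK : forall X : C, lunit X \oc lunitV X = idm _;
  lunit_nat : forall (X Y : C) (f : mor X Y),
    lunit Y \oc tensm (idm unit_ob) f = f \oc lunit X;
  runit : forall X : C, mor (tens X unit_ob) X;
  runitV : forall X : C, mor X (tens X unit_ob);
  runitK : forall X : C, runitV X \oc runit X = idm _;
  runitVK : forall X : C, runit X \oc runitV X = idm _;
  runit_nat : forall (X Y : C) (f : mor X Y),
    runit Y \oc tensm f (idm unit_ob) = f \oc runit X;
  pentagon : forall W X Y Z : C,
    tensm (idm W) (assoc X Y Z) \oc assoc W (tens X Y) Z
        \oc tensm (assoc W X Y) (idm Z)
      = assoc W X (tens Y Z) \oc assoc (tens W X) Y Z;
  triangle : forall X Y : C,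
    tensm (idm X) (lunit Y) \oc assoc X unit_ob Y = tensm (runit X) (idm Y)
}.
Arguments unit_ob {C} monoidal.

Notation "X \ox Y" := (tens X Y) (at level 40, left associativity) : cat_scope.
Notation "f \oxm g" := (tensm f g) (at level 40, left associativity) : cat_scope.

Definition is_left_dual (C : category) (M : monoidal C) (A X : C) : Prop :=
  exists (ev : mor (A \ox X) (unit_ob M)) (coev : mor (unit_ob M) (X \ox A)),
    runit X \oc (idm X \oxm ev) \oc assoc X A X \oc (coev \oxm idm X) \oc lunitV X
      = idm X /\
    lunit A \oc (ev \oxm idm A) \oc assocV A X A \oc (idm A \oxm coev) \oc runitV A
      = idm A.

(* B is a right dual of X (evaluation X \ox B -> 1, coevaluation
   1 -> B \ox X) exactly when X is a left dual of B. *)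
Definition is_right_dual (C : category) (M : monoidal C) (B X : C) : Prop :=
  is_left_dual M X B.

Definition rigid_object (C : category) (M : monoidal C) (X : C) : Prop :=
  (exists A : C, is_left_dual M A X) /\ (exists B : C, is_right_dual M B X).

Definition rigid (C : category) (M : monoidal C) : Prop :=
  forall X : C, rigid_object M X.

(* D X represents Hom(- \ox X, K) for every X.  Naturality of the
   representing bijections in X says that D acts on morphisms as the functor
   induced by the representing objects (this determines [fmap D], by Yoneda). *)
Definition represents_duality (C : category) (M : monoidal C) (K : C)
    (D : functor (opposite C) C) : Prop :=
  exists phi : forall X Y : C, mor (Y \ox X) K -> mor Y (D X),
    [/\ forall X Y : C, bijective (phi X Y),
        forall (X Y Y' : C) (g : mor Y' Y) (h : mor (Y \ox X) K),
          phi X Y' (h \oc (g \oxm idm X)) = phi X Y h \oc g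
      & forall (X X' Y : C) (f : mor X X') (h : mor (Y \ox X') K),
          phi X Y (h \oc (idm Y \oxm f)) = @fmap _ _ D X' X f \oc phi X' Y h].

Definition dualizing (C : category) (M : monoidal C) (K : C) : Prop :=
  exists D : functor (opposite C) C,
    represents_duality M K D /\ is_equivalence D.

Record r_structure (C : category) (M : monoidal C) := RStructure {
  r_ob : C;
  r_dualizing : dualizing M r_ob;
  r_unit : isomorphic r_ob (unit_ob M)
}.

Record linear_category (k : fieldType) := LinearCategory {
  lob : Type;
  lhom : lob -> lob -> lmodType k;
  lid : forall X, lhom X X;
  lcomp : forall X Y Z, lhom Y Z -> lhom X Y -> lhom X Z;
  lcomp1m : forall X Y (f : lhom X Y), lcomp (lid Y) f = f;
  lcompm1 : forall X Y (f : lhom X Y), lcomp f (lid X) = f;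
  lcompmA : forall W X Y Z (h : lhom Y Z) (g : lhom X Y) (f : lhom W X),
    lcomp h (lcomp g f) = lcomp (lcomp h g) f;
  lcomp_linearl : forall X Y Z (f : lhom X Y),
    linear (fun g : lhom Y Z => lcomp g f);
  lcomp_linearr : forall X Y Z (g : lhom Y Z),
    linear (fun f : lhom X Y => lcomp g f)
}.

Coercion cat_of_linear (k : fieldType) (C : linear_category k) : category :=
  @Category (lob C) (fun X Y => lhom X Y) (@lid k C) (@lcomp k C)
    (@lcomp1m k C) (@lcompm1 k C) (@lcompmA k C).

HB.instance Definition _ (k : fieldType) (C : linear_category k) (X Y : C) :=
  GRing.Lmodule.copy (mor X Y) (lhom X Y).

Definition is_kernel (k : fieldType) (C : linear_category k) (N X Y : C)
    (f : mor X Y) (i : mor N X) : Prop :=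
  f \oc i = 0 /\
  forall (W : C) (h : mor W X), f \oc h = 0 -> exists! u : mor W N, i \oc u = h.

Definition is_cokernel (k : fieldType) (C : linear_category k) (X Y Q : C)
    (f : mor X Y) (p : mor Y Q) : Prop :=
  p \oc f = 0 /\
  forall (W : C) (h : mor Y W), h \oc f = 0 -> exists! u : mor Q W, u \oc p = h.

Definition has_biproduct (k : fieldType) (C : linear_category k) (X Y : C) : Prop :=
  exists (S : C) (i1 : mor X S) (i2 : mor Y S) (p1 : mor S X) (p2 : mor S Y),
    [/\ p1 \oc i1 = idm X, p2 \oc i2 = idm Y
      & (i1 \oc p1) + (i2 \oc p2) = idm S].

Record abelian_category (k : fieldType) (C : linear_category k) : Prop := Abelian {
  ab_zero : exists Z : C, zero_object Z;
  ab_biproduct : forall X Y : C, has_biproduct X Y;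
  ab_kernel : forall (X Y : C) (f : mor X Y),
    exists (N : C) (i : mor N X), is_kernel f i;
  ab_cokernel : forall (X Y : C) (f : mor X Y),
    exists (Q : C) (p : mor Y Q), is_cokernel f p;
  ab_mono : forall (X Y : C) (i : mor X Y), monic i ->
    exists (Z : C) (f : mor Y Z), is_kernel f i;
  ab_epi : forall (X Y : C) (p : mor X Y), epic p ->
    exists (Z : C) (f : mor Z X), is_cokernel f p
}.

Definition simple_object (C : category) (S : C) : Prop :=
  ~ zero_object S /\
  forall (A : C) (i : mor A S), monic i -> zero_object A \/ is_iso i.

(* Existence of a composition series, built one simple quotient at a time:
   0 -> A -> X -> S -> 0 is exact in [flen_step]. *)
Inductive finite_length (k : fieldType) (C : linear_category k) : C -> Prop :=
| flen_zero (X : C) : zero_object X -> finite_length X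
| flen_step (A X S : C) (i : mor A X) (p : mor X S) :
    is_kernel p i -> is_cokernel i p -> simple_object S ->
    finite_length A -> finite_length X.

Record locally_finite_abelian (k : fieldType) (C : linear_category k) : Prop :=
  LocallyFiniteAbelian {
    lfa_abelian : abelian_category C;
    lfa_hom : forall X Y : C,
      exists (n : nat) (phi : {linear mor X Y -> 'rV[k]_n}), bijective phi;
    lfa_length : forall X : C, finite_length X
  }.

Definition bilinear_tensor (k : fieldType) (C : linear_category k)
    (M : monoidal C) : Prop :=
  (forall (X X' Y Y' : C) (g : mor Y Y'),
     linear (fun f : mor X X' => f \oxm g)) /\
  (forall (X X' Y Y' : C) (f : mor X X'),
     linear (fun g : mor Y Y' => f \oxm g)).

(* Main.v *)
Require Import Defs.
From HB Require Import structures.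
From mathcomp Require Import all_boot all_order all_algebra.
Set Implicit Arguments.
Unset Strict Implicit.
Unset Printing Implicit Defensive.
Import GRing.Theory.
Local Open Scope ring_scope.
Local Open Scope cat_scope.

(** The unit is dualizing up to isomorphism, so every [X] has a pairing
    [ev : D \ox X -> 1] through which every [Z \ox X -> 1] factors along a
    unique [Z -> D], and every [Y] is the left factor [D] of such a pairing
    with some [W]; the latter uses that the duality functor is essentially
    surjective.  If in such a pairing [D] is a left dual of [X], both halves
    of rigidity follow at once.

    To see that it is, fix [ev] and consider for each [Y] the contraction
    [(Y \ox D) \ox X -> Y].  If it exhibits [Y \ox D] as the internal hom from
    [X] to [Y] ([universal]), then for [Y = X] the identity of [X] transposes
    to a coevaluation [1 -> X \ox D]
    ([left_dual_of_universal_contraction]).  The contraction is universal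

    - for [Y] simple, because [Y] has a left dual [A], and tensoring with [Y]
      on the target side can be traded for tensoring with [A] on the source
      side ([universal_contraction]);

    - for [Y] an extension of [S] by [A], if it is so for [A] and [S]
      ([contraction_extension]).  Internal homs are left exact in [Y] while
      [- \ox D] is right exact, since the two kinds of pairing provide it with
      a right adjoint ([internal_hom_of_pairings], [cokernel_whisker]).
      Universality for [A] makes [A \ox D -> Y \ox D] monic, and then the five
      lemma compares two exact sequences.

    As every object has finite length, this covers all [Y]. *)

(** * Coherence in monoidal categories *)

Section Coherence.
Variables (C : category) (M : monoidal C).
Local Notation "1" := (unit_ob M) : cat_scope.

(** Composites are kept left-associated, so an equation between two factors
    is hidden from rewriting unless they come first; [comp_square],
    [comp_triangle] and [comp_cancel] put a common prefix in front of it. *)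
Lemma comp_square (W X X' Y Z : C) (a : mor X Y) (b : mor W X)
    (c : mor X' Y) (d : mor W X') (x : mor Y Z) :
  a \oc b = c \oc d -> x \oc a \oc b = x \oc c \oc d.
Proof. by move=> e; rewrite -!compmA e. Qed.

Lemma comp_triangle (W X Y Z : C) (a : mor X Y) (b : mor W X) (e : mor W Y)
    (x : mor Y Z) : a \oc b = e -> x \oc a \oc b = x \oc e.
Proof. by move=> <-; rewrite compmA. Qed.

Lemma comp_cancel (X Y Z : C) (a : mor X Y) (b : mor Y X) (x : mor Y Z) :
  a \oc b = idm Y -> x \oc a \oc b = x.
Proof. by move=> e; rewrite -compmA e compm1. Qed.

Lemma split_epi_cancel (X Y Z : C) (a : mor X Y) (b : mor Y X) (u v : mor Y Z) :
  a \oc b = idm Y -> u \oc a = v \oc a -> u = v.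
Proof. by move=> ab e; rewrite -(comp_cancel u ab) e comp_cancel. Qed.

Lemma split_mono_cancel (X Y Z : C) (a : mor X Y) (b : mor Y X) (u v : mor Z X) :
  b \oc a = idm X -> a \oc u = a \oc v -> u = v.
Proof. by move=> ba e; rewrite -(comp1m u) -ba -compmA e compmA ba comp1m. Qed.

Lemma whisker_r (X Y Z W : C) (g : mor Y Z) (f : mor X Y) :
  (g \oc f) \oxm idm W = (g \oxm idm W) \oc (f \oxm idm W).
Proof. by rewrite -tensmM comp1m. Qed.

Lemma whisker_l (X Y Z W : C) (g : mor Y Z) (f : mor X Y) :
  idm W \oxm (g \oc f) = (idm W \oxm g) \oc (idm W \oxm f).
Proof. by rewrite -tensmM comp1m. Qed.

Lemma interchange (X X' Y Y' : C) (f : mor X X') (g : mor Y Y') :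
  (f \oxm idm Y') \oc (idm X \oxm g) = (idm X' \oxm g) \oc (f \oxm idm Y).
Proof. by rewrite -!tensmM !comp1m !compm1. Qed.

Lemma assoc_whisker_l (X Y Z Z' : C) (h : mor Z Z') :
  assoc X Y Z' \oc (idm (X \ox Y) \oxm h)
  = (idm X \oxm (idm Y \oxm h)) \oc assoc X Y Z.
Proof. by rewrite -assoc_nat tensm1. Qed.

Lemma assoc_whisker_r (X X' Y Z : C) (f : mor X X') :
  assoc X' Y Z \oc ((f \oxm idm Y) \oxm idm Z)
  = (f \oxm idm (Y \ox Z)) \oc assoc X Y Z.
Proof. by rewrite assoc_nat tensm1. Qed.

Lemma whisker_r_split (X Y Z : C) (g : mor Y X) (f : mor X Y) :
  g \oc f = idm X -> (g \oxm idm Z) \oc (f \oxm idm Z) = idm (X \ox Z).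
Proof. by move=> e; rewrite -whisker_r e tensm1. Qed.

Lemma whisker_l_split (X Y Z : C) (g : mor Y X) (f : mor X Y) :
  g \oc f = idm X -> (idm Z \oxm g) \oc (idm Z \oxm f) = idm (Z \ox X).
Proof. by move=> e; rewrite -whisker_l e tensm1. Qed.

Lemma unit_whisker_l_inj (X Y : C) (f g : mor X Y) :
  idm 1 \oxm f = idm 1 \oxm g -> f = g.
Proof.
move=> e; apply: (split_epi_cancel (lunitVK X)).
by rewrite -!lunit_nat e.
Qed.

Lemma unit_whisker_r_inj (X Y : C) (f g : mor X Y) :
  f \oxm idm 1 = g \oxm idm 1 -> f = g.
Proof.
move=> e; apply: (split_epi_cancel (runitVK X)).
by rewrite -!runit_nat e.
Qed.

(** Tensoring with the unit is faithful, so it suffices to prove the identity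
    after tensoring with [1] on the left; there the pentagon on
    [1], [1], [X], [Y] reduces it to the triangle. *)
Lemma lunit_tens (X Y : C) :
  lunit (X \ox Y) \oc assoc 1 X Y = lunit X \oxm idm Y.
Proof.
apply: unit_whisker_l_inj; rewrite whisker_l.
apply: (split_epi_cancel (assocVK _ _ _)).
apply: (split_epi_cancel (whisker_r_split Y (assocVK _ _ _))).
rewrite -[in RHS]assoc_nat (comp_triangle _ (esym (whisker_r _ _ _))) triangle.
by rewrite -!compmA (compmA (idm 1 \oxm assoc _ _ _)) pentagon !compmA triangle
  assoc_whisker_r.
Qed.

(** The mirror image of [lunit_tens]: tensor with [1] on the right and use the
    pentagon on [X], [Y], [1], [1]. *)
Lemma runit_tens (X Y : C) :
  (idm X \oxm runit Y) \oc assoc X Y 1 = runit (X \ox Y).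
Proof.
apply: unit_whisker_r_inj; rewrite whisker_r.
apply: (split_mono_cancel (assocK _ _ _)).
rewrite compmA assoc_nat -triangle whisker_l.
rewrite -!compmA (compmA (idm X \oxm assoc _ _ _)) pentagon.
by rewrite !compmA -assoc_whisker_l -compmA triangle.
Qed.

Lemma lunit_unit : lunit 1 = runit 1.
Proof.
apply: unit_whisker_r_inj; rewrite -lunit_tens -triangle.
congr (_ \oc _); apply: (split_mono_cancel (lunitK 1)).
by rewrite lunit_nat.
Qed.

(** * Contractions and universal pairings *)

Definition contraction (D X : C) (ev : mor (D \ox X) 1) (Y : C) :
    mor ((Y \ox D) \ox X) Y :=
  runit Y \oc (idm Y \oxm ev) \oc assoc Y D X.

Lemma contraction_nat (D X : C) (ev : mor (D \ox X) 1) (Y Y' : C) (u : mor Y Y') :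
  u \oc contraction ev Y
  = contraction ev Y' \oc ((u \oxm idm D) \oxm idm X).
Proof.
rewrite /contraction (comp_square _ (assoc_whisker_r _ _ _)).
by rewrite (comp_square _ (esym (interchange _ _))) runit_nat !compmA.
Qed.

(** By the pentagon and the coherence of the unitors it does not matter which
    of two disjoint pairs of tensor factors is contracted first.  Both the comparison with the dual of a simple object and the second
    snake identity are read off from this equation. *)
Lemma pairing_contraction (A S D X Z : C) (ev' : mor (A \ox S) 1)
    (ev : mor (D \ox X) 1) (f : mor Z (S \ox D)) :
  ev \oc ((lunit D \oc (ev' \oxm idm D) \oc assocV A S D
             \oc (idm A \oxm f)) \oxm idm X)
  = ev' \oc (idm A \oxm (contraction ev S \oc (f \oxm idm X)))
        \oc assoc A Z X.
Proof.
rewrite (whisker_r _ _ (idm A \oxm f)) (whisker_l _ _ (f \oxm idm X)).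
rewrite !compmA (comp_square _ (esym (assoc_nat _ _ _))).
congr (_ \oc _).
apply: (split_epi_cancel (whisker_r_split X (assocVK _ _ _))).
rewrite !whisker_r !compmA (comp_cancel _ (whisker_r_split X (assocK _ _ _))).
rewrite /contraction !whisker_l -!compmA (compmA (idm A \oxm assoc _ _ _)) pentagon.
rewrite !compmA (comp_square _ (esym (assoc_whisker_l _ _ _))).
rewrite (comp_triangle _ (runit_tens _ _)) -runit_nat -lunit_unit.
rewrite (comp_square _ (interchange _ _)) lunit_nat.
rewrite (comp_square _ (esym (assoc_whisker_r _ _ _))).
by rewrite (comp_triangle _ (lunit_tens _ _)).
Qed.

(** This says that [c] is the evaluation of an internal hom [E] from [X] to
    [Y]; for [Y = 1] it says that [E] represents the maps [- \ox X -> 1]. *)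
Definition universal (E X Y : C) (c : mor (E \ox X) Y) : Prop :=
  forall (Z : C) (h : mor (Z \ox X) Y),
    exists! g : mor Z E, c \oc (g \oxm idm X) = h.

Lemma universal_inj (E X Y : C) (c : mor (E \ox X) Y) (Z : C) (g g' : mor Z E) :
  universal c -> c \oc (g \oxm idm X) = c \oc (g' \oxm idm X) -> g = g'.
Proof.
move=> uc e; have [u [_ u_uniq]] := uc _ (c \oc (g' \oxm idm X)).
by rewrite -(u_uniq _ e) -(u_uniq g').
Qed.

(** By the pentagon, the composite on [S \ox V] is the first snake composite
    on [S] whiskered by [V]. *)
Lemma snake_tens (A S : C) (ev' : mor (A \ox S) 1) (coev : mor 1 (S \ox A)) V :
  runit S \oc (idm S \oxm ev') \oc assoc S A S \oc (coev \oxm idm S)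
    \oc lunitV S = idm S ->
  (idm S \oxm (lunit V \oc (ev' \oxm idm V) \oc assocV A S V))
     \oc assoc S A (S \ox V) \oc (coev \oxm idm (S \ox V)) \oc lunitV (S \ox V)
  = idm (S \ox V).
Proof.
move=> snake.
apply: (split_epi_cancel (lunitVK _)).
rewrite (comp_cancel _ (lunitK _)) comp1m.
apply: (split_epi_cancel (assocVK _ _ _)).
rewrite lunit_tens (comp_square _ (esym (assoc_whisker_r _ _ _))).
rewrite !whisker_l.
rewrite -[_ \oc assoc S A _ \oc _]compmA -pentagon !compmA.
rewrite (comp_cancel _ (whisker_l_split S (assocK _ _ _))).
rewrite (comp_square _ (esym (assoc_nat _ _ _))) triangle.
rewrite -!whisker_r; congr (_ \oxm _).
by apply: (split_epi_cancel (lunitK S)); rewrite snake lunitVK.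
Qed.

(** Maps [Z -> S \ox D] correspond to maps [A \ox Z -> D], hence to maps
    [(A \ox Z) \ox X -> 1], hence to maps [Z \ox X -> S], and
    [pairing_contraction] identifies the composite with the contraction.  The
    first snake identity shows both that a map [Z -> S \ox D] is determined by
    its mate [A \ox Z -> D] and that the one built from [h] contracts to
    [h]. *)
Lemma universal_contraction (A S D X : C) (ev : mor (D \ox X) 1) :
  is_left_dual M A S -> universal ev -> universal (contraction ev S).
Proof.
move=> [ev' [coev [snake _]]] uev.
have inj Z (f f' : mor Z (S \ox D)) :
    contraction ev S \oc (f \oxm idm X) = contraction ev S \oc (f' \oxm idm X) ->
    f = f'.
  pose mate W (g : mor W (S \ox D)) :=
    lunit D \oc (ev' \oxm idm D) \oc assocV A S D \oc (idm A \oxm g).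
  have mateK W (g : mor W (S \ox D)) :
      (idm S \oxm mate W g) \oc assoc S A W \oc (coev \oxm idm W) \oc lunitV W = g.
    rewrite -[RHS]comp1m -(snake_tens D snake).
    apply: (split_epi_cancel (lunitVK W)).
    rewrite (comp_cancel _ (lunitK _)) -[RHS]compmA -lunit_nat.
    rewrite compmA (comp_cancel _ (lunitK _)) (comp_square _ (interchange _ _)).
    by rewrite (comp_square _ (assoc_whisker_l _ _ _)) -whisker_l.
  move=> e; rewrite -(mateK _ f) -(mateK _ f').
  suff -> : mate _ f = mate _ f' by [].
  by apply: (universal_inj uev); rewrite !pairing_contraction e.
move=> Z h.
have [g [ge _]] := uev _ (ev' \oc (idm A \oxm h) \oc assoc A Z X).
pose f := (idm S \oxm g) \oc assoc S A Z \oc (coev \oxm idm Z) \oc lunitV Z.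
suff fh : contraction ev S \oc (f \oxm idm X) = h.
  by exists f; split=> // f' f'h; apply: inj; rewrite fh.
rewrite /f !whisker_r !compmA /contraction (comp_square _ (assoc_nat _ _ _)).
rewrite (comp_triangle _ (esym (whisker_l _ _ _))) ge !whisker_l.
rewrite !compmA -(compmA _ (idm S \oxm assoc _ _ _)).
rewrite -(compmA _ (_ \oc _) (_ \oxm _)).
rewrite pentagon !compmA.
rewrite (comp_square _ (esym (assoc_whisker_l _ _ _))).
rewrite (comp_square _ (assoc_whisker_r _ _ _)).
rewrite (comp_square _ (esym (interchange _ _))).
apply: (split_epi_cancel (whisker_r_split X (lunitVK Z))).
rewrite (comp_cancel _ (whisker_r_split X (lunitK Z))).
rewrite -[in RHS]lunit_tens compmA -lunit_nat.
congr (_ \oc _ \oc _).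
by apply: (split_epi_cancel (lunitK S)); rewrite snake lunitVK.
Qed.

(** The transpose of the left unitor is a coevaluation.  Its defining equation
    is the first snake identity; the second is an equality of maps [D -> D],
    which universality of [ev] allows to test after pairing with [X]. *)
Lemma left_dual_of_universal_contraction (D X : C) (ev : mor (D \ox X) 1) :
  universal ev -> universal (contraction ev X) -> is_left_dual M D X.
Proof.
move=> uev uX; have [coev [e _]] := uX _ (lunit X).
exists ev, coev; split; first by rewrite [X in X \oc _]e lunitVK.
apply: (split_epi_cancel (runitVK D)); rewrite (comp_cancel _ (runitK D)) comp1m.
by apply: (universal_inj uev); rewrite pairing_contraction e -compmA triangle.
Qed.

(** If [Y] is the object of maps [- \ox W -> 1], then maps [Z \ox X -> Y] are
    maps [Z \ox (X \ox W) -> 1], and these are represented by [E]. *)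
Lemma internal_hom_of_pairings (X Y W E : C) (ev : mor (Y \ox W) 1)
    (e : mor (E \ox (X \ox W)) 1) :
  universal ev -> universal e -> exists c : mor (E \ox X) Y, universal c.
Proof.
move=> uev ue.
have [c [ce _]] := uev _ (e \oc assoc E X W).
have cE Z (g : mor Z E) : ev \oc ((c \oc (g \oxm idm X)) \oxm idm W)
    = e \oc (g \oxm idm (X \ox W)) \oc assoc Z X W.
  by rewrite whisker_r compmA ce (comp_square _ (assoc_whisker_r _ _ _)).
exists c => Z h.
have [g [ge g_uniq]] := ue _ (ev \oc (h \oxm idm W) \oc assocV Z X W).
exists g; split.
  by apply: (universal_inj uev); rewrite cE ge (comp_cancel _ (assocK _ _ _)).
move=> g' g'h; apply: g_uniq.
by rewrite -g'h cE (comp_cancel _ (assocVK _ _ _)).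
Qed.

End Coherence.

(** * Universal pairings in an r-category *)

Section Duality.
Variables (C : category) (M : monoidal C).
Local Notation "1" := (unit_ob M) : cat_scope.

Lemma universal_post_iso (D X Y Y' : C) (c : mor (D \ox X) Y)
    (a : mor Y Y') (b : mor Y' Y) : b \oc a = idm Y -> a \oc b = idm Y' ->
  universal c -> universal (a \oc c).
Proof.
move=> ba ab uc Z h; have [g [ge g_uniq]] := uc _ (b \oc h).
exists g; split; first by rewrite -compmA ge compmA ab comp1m.
by move=> g' g'h; apply: g_uniq; rewrite -g'h !compmA ba comp1m.
Qed.

Lemma universal_pre_iso (D D' X Y : C) (c : mor (D \ox X) Y)
    (a : mor D' D) (b : mor D D') : b \oc a = idm D' -> a \oc b = idm D ->
  universal c -> universal (c \oc (a \oxm idm X)).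
Proof.
move=> ba ab uc Z h; have [g [ge g_uniq]] := uc _ h.
exists (b \oc g); split; first by rewrite -compmA -whisker_r compmA ab comp1m.
move=> g' g'h; rewrite (g_uniq (a \oc g')); first by rewrite compmA ba comp1m.
by rewrite whisker_r compmA.
Qed.

(** Yoneda: the universal pairing corresponds to the identity of [D X] under
    the representing bijection. *)
Lemma dualizing_universal (K : C) (D : functor (opposite C) C) (X : C) :
  represents_duality M K D -> exists c : mor (D X \ox X) K, universal c.
Proof.
case=> phi [phi_bij phi_nat _].
have [phiV phiK phiVK] := phi_bij X (D X).
exists (phiV (idm _)) => Z h.
have phiE (g : mor Z (D X)) : phi X Z (phiV (idm _) \oc (g \oxm idm X)) = g.
  by rewrite phi_nat phiVK comp1m.
exists (phi X Z h); split; last by move=> g <-.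
by apply: (bij_inj (phi_bij X Z)); rewrite phiE.
Qed.

Lemma r_universal_left (R : r_structure M) (X : C) :
  exists (D : C) (ev : mor (D \ox X) 1), universal ev.
Proof.
case: R => K [D [repD _]] [a [b [ba ab]]].
have [c uc] := dualizing_universal X repD.
by exists (D X), (a \oc c); apply: universal_post_iso ba ab uc.
Qed.

Lemma r_universal_right (R : r_structure M) (Y : C) :
  exists (W : C) (ev : mor (Y \ox W) 1), universal ev.
Proof.
case: R => K [D [repD [G [_ [beta [beta_iso _]]]]]] [a [b [ba ab]]].
have [s [sb bs]] := beta_iso Y.
have [c uc] := dualizing_universal (G Y) repD.
exists (G Y), (a \oc (c \oc (s \oxm idm _))).
by apply: (universal_post_iso ba ab); apply: universal_pre_iso bs sb uc.
Qed.

End Duality.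

(** * Exactness in linear abelian categories *)

Section Linear.
Variables (k : fieldType) (C : linear_category k).

Lemma linear_at0 (U V : lmodType k) (f : U -> V) : linear f -> f 0 = 0.
Proof. by move=> lf; rewrite -[X in f X](addNr 0) -scaleN1r lf scaleN1r addNr. Qed.

Lemma linear_atB (U V : lmodType k) (f : U -> V) u v :
  linear f -> f (u - v) = f u - f v.
Proof. by move=> lf; rewrite addrC -scaleN1r lf scaleN1r addrC. Qed.

Lemma comp0m (X Y Z : C) (f : mor X Y) : (0 : mor Y Z) \oc f = 0.
Proof. exact: linear_at0 (lcomp_linearl f). Qed.

Lemma compm0 (X Y Z : C) (f : mor Y Z) : f \oc (0 : mor X Y) = 0.
Proof. exact: linear_at0 (lcomp_linearr f). Qed.

Lemma compBm (X Y Z : C) (f : mor X Y) (g h : mor Y Z) :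
  (g - h) \oc f = (g \oc f) - (h \oc f).
Proof. exact: linear_atB (lcomp_linearl f). Qed.

Lemma compmB (X Y Z : C) (f : mor Y Z) (g h : mor X Y) :
  f \oc (g - h) = (f \oc g) - (f \oc h).
Proof. exact: linear_atB (lcomp_linearr f). Qed.

Lemma zero_object_idm0 (Z : C) : zero_object Z -> idm Z = 0.
Proof.
move=> /(_ Z) [[f [_ f_uniq]] _].
by rewrite -(f_uniq (idm Z)) // -(f_uniq 0).
Qed.

Lemma mor_to_zero (X Z : C) (f : mor X Z) : idm Z = 0 -> f = 0.
Proof. by move=> z; rewrite -(comp1m f) z comp0m. Qed.

Lemma cokernel_epi (X Y Q Z : C) (f : mor X Y) (p : mor Y Q) (u v : mor Q Z) :
  is_cokernel f p -> u \oc p = v \oc p -> u = v.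
Proof.
case=> pf0 pu e; have [|w [_ w_uniq]] := pu _ (v \oc p).
  by rewrite -compmA pf0 compm0.
by rewrite -(w_uniq _ e) -(w_uniq v).
Qed.

Lemma kernel_mono (N X Y Z : C) (f : mor X Y) (i : mor N X) (u v : mor Z N) :
  is_kernel f i -> i \oc u = i \oc v -> u = v.
Proof.
case=> fi0 iu e; have [|w [_ w_uniq]] := iu _ (i \oc v).
  by rewrite compmA fi0 comp0m.
by rewrite -(w_uniq _ e) -(w_uniq v).
Qed.

Lemma kernel_lift (N X Y Z : C) (f : mor X Y) (i : mor N X) (h : mor Z X) :
  is_kernel f i -> f \oc h = 0 -> exists u, i \oc u = h.
Proof. by move=> [_ iu] /iu [u [e _]]; exists u. Qed.

Lemma cokernel_desc (X Y Q Z : C) (f : mor X Y) (p : mor Y Q) (h : mor Y Z) :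
  is_cokernel f p -> h \oc f = 0 -> exists u, u \oc p = h.
Proof. by move=> [_ pu] /pu [u [e _]]; exists u. Qed.

Lemma monic_reflecting_zero (X Y : C) (f : mor X Y) :
  (forall W (u : mor W X), f \oc u = 0 -> u = 0) -> Defs.monic f.
Proof.
move=> f0 W u v /eqP; rewrite -subr_eq0 -compmB => /eqP /f0 /eqP.
by rewrite subr_eq0 => /eqP.
Qed.

Lemma epic_reflecting_zero (X Y : C) (f : mor X Y) :
  (forall W (u : mor Y W), u \oc f = 0 -> u = 0) -> epic f.
Proof.
move=> f0 W u v /eqP; rewrite -subr_eq0 -compBm => /eqP /f0 /eqP.
by rewrite subr_eq0 => /eqP.
Qed.

Hypothesis abC : abelian_category C.

Lemma monic_kernel_cokernel (X Y Q : C) (i : mor X Y) (p : mor Y Q) :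
  Defs.monic i -> is_cokernel i p -> is_kernel p i.
Proof.
move=> /(ab_mono abC)[Z [f ki]] cp; split=> [|W h ph0]; first by case: cp.
have [|u e] := @kernel_lift _ _ _ _ f i h ki.
  have [|v <-] := cokernel_desc cp (h := f); first by case: ki.
  by rewrite -compmA ph0 compm0.
by exists u; split=> // u' e'; apply: (kernel_mono ki); rewrite e.
Qed.

Lemma epic_cokernel_kernel (X Y N : C) (p : mor X Y) (i : mor N X) :
  epic p -> is_kernel p i -> is_cokernel i p.
Proof.
move=> /(ab_epi abC)[Z [f cp]] ki; split=> [|W h hi0]; first by case: ki.
have [|u e] := @cokernel_desc _ _ _ _ f p h cp.
  have [|v <-] := kernel_lift ki (h := f); first by case: cp.
  by rewrite compmA hi0 comp0m.
by exists u; split=> // u' e'; apply: (cokernel_epi cp); rewrite e.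
Qed.

(** The pullback [P] is the kernel of [d = g - p : Z (+) X -> Y].  As [p] is
    epic, so is [d], hence [d] is the cokernel of [P -> Z (+) X].  A map out of
    [Z] that vanishes on [P] thus factors through [d], by a map that kills [p]
    and so is zero: the projection [e] is epic, hence the cokernel of its
    kernel [n]. *)
Lemma epi_pullback (X Y Z : C) (g : mor Z Y) (p : mor X Y) : epic p ->
  exists (P N : C) (e : mor P Z) (n : mor N P) (q : mor P X),
    is_cokernel n e /\ g \oc e = p \oc q.
Proof.
move=> ep.
have [S [i1 [i2 [p1 [p2 [pi1 pi2 sum1]]]]]] := ab_biproduct abC Z X.
(* The biproduct equations give [p1 \oc i2 \oc p2 = 0], and [p2] is split
   epic. *)
have p1i2 : p1 \oc i2 = 0.
  have p1E : p1 \oc (i2 \oc p2) = 0.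
    have -> : i2 \oc p2 = idm S - (i1 \oc p1) by rewrite -sum1 addrC addKr.
    by rewrite compmB compm1 compmA pi1 comp1m subrr.
  by rewrite -(compm1 i2) -pi2 !compmA -(compmA p1) p1E comp0m.
pose d : mor S Y := (g \oc p1) - (p \oc p2).
have di2 : d \oc i2 = 0 - p.
  by rewrite compBm -!compmA p1i2 pi2 compm0 compm1.
have ed : epic d.
  apply: epic_reflecting_zero => W u ud0; apply: ep; rewrite comp0m.
  have : u \oc (0 - p) = 0 by rewrite -di2 compmA ud0 comp0m.
  by rewrite compmB compm0 sub0r => /eqP; rewrite oppr_eq0 => /eqP.
have [P [j kj]] := ab_kernel abC d.
have cd := epic_cokernel_kernel ed kj.
have ee : epic (p1 \oc j).
  apply: epic_reflecting_zero => W u; rewrite compmA => uj0.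
  have [v ve] := cokernel_desc cd uj0.
  have v0 : v = 0.
    apply: ep; rewrite comp0m.
    have : v \oc (0 - p) = 0 by rewrite -di2 compmA ve -compmA p1i2 compm0.
    by rewrite compmB compm0 sub0r => /eqP; rewrite oppr_eq0 => /eqP.
  by rewrite -(compm1 u) -pi1 compmA -ve v0 !comp0m.
have [N [n kn]] := ab_kernel abC (p1 \oc j).
exists P, N, (p1 \oc j), n, (p2 \oc j); split.
  exact: epic_cokernel_kernel kn.
apply/eqP; rewrite -subr_eq0 !compmA -compBm; apply/eqP.
by case: kj.
Qed.

(** * Contractions along a composition series *)

Variables (M : monoidal C).
Hypothesis hM : bilinear_tensor M.
Local Notation "1" := (unit_ob M) : cat_scope.

Lemma whisker_r0 (X Y W : C) : (0 : mor X Y) \oxm idm W = 0.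
Proof. exact: linear_at0 (hM.1 X Y W W (idm W)). Qed.

Lemma whisker_rB (X Y W : C) (f g : mor X Y) :
  (f - g) \oxm idm W = (f \oxm idm W) - (g \oxm idm W).
Proof. exact: linear_atB (hM.1 X Y W W (idm W)). Qed.

Hypothesis internal_homs : forall X Y : C,
  exists (E : C) (c : mor (E \ox X) Y), universal c.

(** The functor [- \ox X] has a right adjoint, given by the internal homs, so
    it preserves cokernels. *)
Lemma cokernel_whisker (A B Q X : C) (i : mor A B) (p : mor B Q) :
  is_cokernel i p -> is_cokernel (i \oxm idm X) (p \oxm idm X).
Proof.
move=> cp; have [pi0 _] := cp.
split; first by rewrite -whisker_r pi0 whisker_r0.
move=> Y h hi0; have [E [c uc]] := internal_homs X Y.
have [g [ge _]] := uc _ h.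
have gi0 : g \oc i = 0.
  by apply: (universal_inj uc); rewrite whisker_r compmA ge hi0 whisker_r0 compm0.
have [g' g'e] := cokernel_desc cp gi0.
exists (c \oc (g' \oxm idm X)); split; first by rewrite -compmA -whisker_r g'e.
move=> h' h'e; have [u [ue _]] := uc _ h'; rewrite -ue; congr (c \oc (_ \oxm _)).
apply: (cokernel_epi cp); rewrite g'e; apply: (universal_inj uc).
by rewrite whisker_r compmA ue h'e ge.
Qed.

Section Extension.
Variables (D X : C) (ev : mor (D \ox X) 1).

Lemma contraction0_inj (Y Z : C) (f : mor Z (Y \ox D)) :
  universal (contraction ev Y) ->
  contraction ev Y \oc (f \oxm idm X) = 0 -> f = 0.
Proof. by move=> uY e; apply: (universal_inj uY); rewrite e whisker_r0 compm0. Qed.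

(** A five lemma, run on maps out of an arbitrary [Z].  Given
    [h : Z \ox X -> Y], the map [g : Z -> S \ox D] that corresponds to
    [p \oc h] need not lift to [Y \ox D], but it does so after pulling back
    along an epimorphism [e : P -> Z].  The lift is corrected by a map into
    [A \ox D], and the result descends to [Z] by injectivity. *)
Lemma contraction_extension (A Y S : C) (i : mor A Y) (p : mor Y S) :
  is_kernel p i -> is_cokernel i p ->
  universal (contraction ev A) -> universal (contraction ev S) ->
  universal (contraction ev Y).
Proof.
move=> ki cp uA uS.
have i0 Z (u : mor Z A) : i \oc u = 0 -> u = 0.
  by move=> e; apply: (kernel_mono ki); rewrite e compm0.
have push (Y1 Y2 Z : C) (u : mor Y1 Y2) (f : mor Z (Y1 \ox D)) :
    contraction ev Y2 \oc (((u \oxm idm D) \oc f) \oxm idm X)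
    = u \oc (contraction ev Y1 \oc (f \oxm idm X)).
  by rewrite whisker_r [RHS]compmA contraction_nat compmA.
have cpD := cokernel_whisker D cp.
have kiD : is_kernel (p \oxm idm D) (i \oxm idm D).
  apply: monic_kernel_cokernel cpD; apply: monic_reflecting_zero => Z u iu0.
  apply: (contraction0_inj uA); apply: i0.
  by rewrite -push iu0 whisker_r0 compm0.
have injY Z (f : mor Z (Y \ox D)) :
    contraction ev Y \oc (f \oxm idm X) = 0 -> f = 0.
  move=> f0; have [|f' f'e] := kernel_lift kiD (h := f).
    by apply: (contraction0_inj uS); rewrite push f0 compm0.
  rewrite -f'e; suff -> : f' = 0 by rewrite compm0.
  by apply: (contraction0_inj uA); apply: i0; rewrite -push f'e.
move=> Z h.
have [g [ge _]] := uS _ (p \oc h).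
have epD : epic (p \oxm idm D) by move=> W u v; exact: cokernel_epi cpD.
(* [q] lifts [g] after restriction along the epimorphism [e]. *)
have [P [N [e [n [q [ce gq]]]]]] := epi_pullback g epD.
have ceX := cokernel_whisker X ce.
(* The error of [q] maps to zero in [S], hence comes from [A \ox D]. *)
have [|a ae] := kernel_lift ki
  (h := (contraction ev Y \oc (q \oxm idm X)) - (h \oc (e \oxm idm X))).
  by rewrite compmB -push -gq whisker_r !compmA ge subrr.
have [a' [a'e _]] := uA _ a.
pose f := q - ((i \oxm idm D) \oc a').
have fe : contraction ev Y \oc (f \oxm idm X) = h \oc (e \oxm idm X).
  by rewrite whisker_rB compmB push a'e ae opprB addrC subrK.
(* [f] kills [n]: restricted along [n], its contraction factors through
   [e \oc n = 0], and [injY] applies. *)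
have [|f' f'e] := cokernel_desc ce (h := f).
  apply: injY; rewrite whisker_r compmA fe -compmA.
  by case: ceX => -> _; rewrite compm0.
have f'h : contraction ev Y \oc (f' \oxm idm X) = h.
  by apply: (cokernel_epi ceX); rewrite -compmA -whisker_r f'e.
exists f'; split=> // f'' f''h; apply/eqP; rewrite -subr_eq0; apply/eqP.
by apply: injY; rewrite whisker_rB compmB f'h f''h subrr.
Qed.

Lemma contraction_zero (Y : C) : zero_object Y -> universal (contraction ev Y).
Proof.
move=> /zero_object_idm0 Y0 Z h.
have YD0 : idm (Y \ox D) = 0 by rewrite -tensm1 Y0 whisker_r0.
exists 0; split; first by rewrite (mor_to_zero h Y0) (mor_to_zero (_ \oc _) Y0).
by move=> g _; rewrite (mor_to_zero g YD0).
Qed.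

Lemma contraction_finite_length :
  (forall S : C, simple_object S -> exists A, is_left_dual M A S) ->
  universal ev -> forall Y : C, finite_length Y -> universal (contraction ev Y).
Proof.
move=> simple_dual uev Y.
elim=> [{}Y /contraction_zero //|A {}Y S i p ki cp sS _ uA].
have [B dB] := simple_dual S sS.
exact: contraction_extension ki cp uA (universal_contraction dB uev).
Qed.

End Extension.

End Linear.

Theorem theorem3p13 (k : fieldType) (C : linear_category k) (M : monoidal C)
    (hC : locally_finite_abelian C) (hM : bilinear_tensor M)
    (R : r_structure M)
    (hsimple : forall S : C, simple_object S -> rigid_object M S) :
  rigid M.
Proof.
have internal_homs (X Y : C) : exists (E : C) (c : mor (E \ox X) Y), universal c.
  have [W [ev uev]] := r_universal_right R Y.
  have [E [e ue]] := r_universal_left R (X \ox W).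
  by exists E; apply: internal_hom_of_pairings uev ue.
have dual (D X : C) (ev : mor (D \ox X) (unit_ob M)) :
    universal ev -> is_left_dual M D X.
  move=> uev; apply: (left_dual_of_universal_contraction uev).
  apply: (contraction_finite_length (lfa_abelian hC) hM internal_homs) => //.
    by move=> S /hsimple[].
  exact: lfa_length hC X.
move=> X; split.
  by have [D [ev /dual dX]] := r_universal_left R X; exists D.
by have [W [ev /dual dW]] := r_universal_right R X; exists W.
Qed.
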